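(* Let $\alpha>0$ and let $\varphi(\mathbf{x})=\exp(-\pi\mathbf{x}^2)=\exp(-\pi x_1^2-\pi x_2^2)$ for $\mathbf{x}=(x_1,x_2)\in\mathbb{R}^2$. Then the quaternionic Gabor system $\mathcal{G}_q(\varphi,\alpha,\tfrac{1}{\alpha})$ is not a frame for $L^2(\mathbb{R}^2,\mathbb{H})$.
   Context: $\mathbb{H}$ denotes the quaternions $q = q_0+q_1 i+q_2 j+q_3 k$ ($q_0,\dots,q_3\in\mathbb{R}$), with $ij=-ji=k$, $i^2=j^2=k^2=ijk=-1$; $\mathrm{Sc}[q]=q_0$, $\overline{q}=q_0-q_1i-q_2j-q_3k$, $|q|^2=q\overline{q}$. $L^2(\mathbb{R}^2,\mathbb{H})$ is the space of square-integrable functions $f:\mathbb{R}^2\to\mathbb{H}$, regarded as a real Hilbert space with the real scalar product $\langle f,h\rangle = \mathrm{Sc}\int_{\mathbb{R}^2} f(\mathbf{x})\overline{h(\mathbf{x})}\,d^2\mathbf{x}$ and norm $\|f\|_2$ (also written $\|f\|$). $L^2(\mathbb{R}^2,\mathbb{R})$ is the space of real-valued square-integrable functions. Carriers: for $p,q\in\mathbb{H}$, $C_r(p)q=qp$ and $qC_l(p)=pq$; $C_r(p)1=1C_l(p)=p$, $\overline{C_r(p)}=C_l(\overline{p})$. Translation and modulation: for $\mathbf{b},\omega\in\mathbb{R}^2$, $T_{\mathbf{b}}g(\mathbf{x})=g(\mathbf{x}-\mathbf{b})$ and $M_\omega g(\mathbf{x})=\exp(2\pi j\omega_2x_2)\,g(\mathbf{x})\,C_r(\exp(2\pi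 i\omega_1x_1))$. By the carrier convention, for $f\in L^2(\mathbb{R}^2,\mathbb{H})$ and real-valued $g$ the pairing with $M_\omega T_{\mathbf{b}}g$ means $$\langle f, M_\omega T_{\mathbf{b}} g\rangle = \mathrm{Sc}\int_{\mathbb{R}^2}\exp(-2\pi i x_1\omega_1)\,f(\mathbf{x})\,g(\mathbf{x}-\mathbf{b})\,\exp(-2\pi j x_2\omega_2)\,d^2\mathbf{x}.$$ Quaternionic Gabor system: for $\alpha,\beta>0$ and $g\in L^2(\mathbb{R}^2,\mathbb{R})$, $\mathcal{G}_q(g,\alpha,\beta)=\{M_{\beta\mathbf{n}}T_{\alpha\mathbf{m}}g : \mathbf{m},\mathbf{n}\in\mathbb{Z}^2\}$. It is a frame for $L^2(\mathbb{R}^2,\mathbb{H})$ if there are real constants $A,B>0$ with $$A\|f\|^2\le\sum_{\mathbf{m},\mathbf{n}\in\mathbb{Z}^2}|\langle f,M_{\beta\mathbf{n}}T_{\alpha\mathbf{m}}g\rangle|^2\le B\|f\|^2\qquad\forall f\in L^2(\mathbb{R}^2,\mathbb{H}).$$ *)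

(* Defs.v *)
From HB Require Import structures.
From mathcomp Require Import all_boot all_order all_algebra.
From mathcomp Require Import all_classical all_reals all_analysis.
From mathcomp Require Import ring.

Set Implicit Arguments.
Unset Strict Implicit.
Unset Printing Implicit Defensive.

Import Order.TTheory GRing.Theory Num.Theory.
Import numFieldNormedType.Exports.

Local Open Scope classical_set_scope.
Local Open Scope ring_scope.

Record quat (R : Type) := Quat { q0 : R; q1 : R; q2 : R; q3 : R }.

Section QuatRing.
Variable R : comNzRingType.
Implicit Types p q r : quat R.

Definition prod_of_quat q := (q0 q, q1 q, q2 q, q3 q).
Definition quat_of_prod (t : R * R * R * R) :=
  Quat t.1.1.1 t.1.1.2 t.1.2 t.2.

Lemma prod_of_quatK : cancel prod_of_quat quat_of_prod.
Proof. by case. Qed.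

HB.instance Definition _ := Choice.copy (quat R) (can_type prod_of_quatK).

Definition quat_zero : quat R := Quat 0 0 0 0.
Definition quat_one : quat R := Quat 1 0 0 0.
Definition quat_opp q := Quat (- q0 q) (- q1 q) (- q2 q) (- q3 q).
Definition quat_add p q :=
  Quat (q0 p + q0 q) (q1 p + q1 q) (q2 p + q2 q) (q3 p + q3 q).
Definition quat_mul p q :=
  Quat (q0 p * q0 q - q1 p * q1 q - q2 p * q2 q - q3 p * q3 q)
       (q0 p * q1 q + q1 p * q0 q + q2 p * q3 q - q3 p * q2 q)
       (q0 p * q2 q - q1 p * q3 q + q2 p * q0 q + q3 p * q1 q)
       (q0 p * q3 q + q1 p * q2 q - q2 p * q1 q + q3 p * q0 q).

Lemma quat_addA : associative quat_add.
Proof. by case=> [????] [????] [????]; rewrite /quat_add /= !addrA. Qed.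
Lemma quat_addC : commutative quat_add.
Proof. by case=> [????] [????]; congr Quat; rewrite /= addrC. Qed.
Lemma quat_add0 : left_id quat_zero quat_add.
Proof. by case=> [????]; rewrite /quat_add /= !add0r. Qed.
Lemma quat_addN : left_inverse quat_zero quat_opp quat_add.
Proof. by case=> [????]; rewrite /quat_add /= !addNr. Qed.

HB.instance Definition _ :=
  GRing.isZmodule.Build (quat R) quat_addA quat_addC quat_add0 quat_addN.

Lemma quat_mulA : associative quat_mul.
Proof. by case=> [????] [????] [????]; congr Quat; rewrite /=; ring. Qed.
Lemma quat_mul1q : left_id quat_one quat_mul.
Proof. by case=> [????]; congr Quat; rewrite /=; ring. Qed.
Lemma quat_mulq1 : right_id quat_one quat_mul.
Proof. by case=> [????]; congr Quat; rewrite /=; ring. Qed.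
Lemma quat_mulDl : left_distributive quat_mul quat_add.
Proof. by case=> [????] [????] [????]; congr Quat; rewrite /=; ring. Qed.
Lemma quat_mulDr : right_distributive quat_mul quat_add.
Proof. by case=> [????] [????] [????]; congr Quat; rewrite /=; ring. Qed.
Lemma quat_1neq0 : quat_one != quat_zero.
Proof. by apply/eqP => -[] /eqP; rewrite oner_eq0. Qed.

HB.instance Definition _ := GRing.Zmodule_isNzRing.Build (quat R)
  quat_mulA quat_mul1q quat_mulq1 quat_mulDl quat_mulDr quat_1neq0.

Definition quat_real (t : R) : quat R := Quat t 0 0 0.
Definition quat_i : quat R := Quat 0 1 0 0.
Definition quat_j : quat R := Quat 0 0 1 0.
Definition quat_k : quat R := Quat 0 0 0 1.

Definition Sc q : R := q0 q.
Definition quat_conj q := Quat (q0 q) (- q1 q) (- q2 q) (- q3 q).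

Lemma quat_ij : quat_i * quat_j = quat_k.
Proof. by congr Quat; rewrite /=; ring. Qed.
Lemma quat_ji : quat_j * quat_i = - quat_k.
Proof. by congr Quat; rewrite /=; ring. Qed.
Lemma quat_ii : quat_i * quat_i = -1.
Proof. by congr Quat; rewrite /=; ring. Qed.
Lemma quat_jj : quat_j * quat_j = -1.
Proof. by congr Quat; rewrite /=; ring. Qed.
Lemma quat_kk : quat_k * quat_k = -1.
Proof. by congr Quat; rewrite /=; ring. Qed.

(* [RCar a p] stands for the carried quaternion "a C_r(p)" and [LCar p a] for
   "C_l(p) a".  A carrier has no value until something is placed on its far
   side: "a C_r(p)" times q is a (q p), and q times "C_l(p) a" is (p q) a. *)
Record rcarried := RCar { rcoef : quat R; rcar : quat R }.
Record lcarried := LCar { lcar : quat R; lcoef : quat R }.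

(* conj (a C_r(p)) = C_l(conj p) conj(a). *)
Definition rcarried_conj (h : rcarried) : lcarried :=
  LCar (quat_conj (rcar h)) (quat_conj (rcoef h)).

Definition mul_lcarried q (h : lcarried) : quat R := lcar h * q * lcoef h.

End QuatRing.

Section QuatAnalysis.
Variable R : realType.
Implicit Types (q : quat R) (f h : R * R -> quat R).

Definition quat_abs q : R := Num.sqrt (Sc (q * quat_conj q)).

(* Coordinatewise sum of the exponential series. *)
Definition quat_exp q : quat R :=
  let S (c : quat R -> R) :=
    lim (series [sequence c (q ^+ n) / n`!%:R]_n @ \oo) in
  Quat (S (@q0 R)) (S (@q1 R)) (S (@q2 R)) (S (@q3 R)).

Definition lebesgue2 :
    {measure set (measurableTypeR R * measurableTypeR R) -> \bar R} :=
  (@lebesgue_measure R \x @lebesgue_measure R)%E.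

Definition quat_int f : quat R :=
  let I (c : quat R -> R) := \int[lebesgue2]_x c (f x) in
  Quat (I (@q0 R)) (I (@q1 R)) (I (@q2 R)) (I (@q3 R)).

(* Square-integrable functions, not quotiented by almost-everywhere equality. *)
Definition L2 f : Prop :=
  let plane := [set: measurableTypeR R * measurableTypeR R] in
  [/\ measurable_fun plane (fun x => q0 (f x)),
      measurable_fun plane (fun x => q1 (f x)),
      measurable_fun plane (fun x => q2 (f x)),
      measurable_fun plane (fun x => q3 (f x)) &
      (\int[lebesgue2]_x (quat_abs (f x) ^+ 2)%:E < +oo)%E].

Definition L2inner f h : R := Sc (quat_int (fun x => f x * quat_conj (h x))).
Definition L2norm f : R := Num.sqrt (L2inner f f).

Definition L2pairing f (h : R * R -> rcarried R) : R :=
  Sc (quat_int (fun x => mul_lcarried (f x) (rcarried_conj (h x)))).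

Definition translation (T : Type) (b : R * R) (g : R * R -> T) : R * R -> T :=
  fun x => g (x.1 - b.1, x.2 - b.2).

Definition modulation (w : R * R) f : R * R -> rcarried R := fun x =>
  RCar (quat_exp (quat_real (2 * pi * w.2 * x.2) * quat_j R) * f x)
       (quat_exp (quat_real (2 * pi * w.1 * x.1) * quat_i R)).

Definition lattice (c : R) (n : int * int) : R * R := (c * n.1%:~R, c * n.2%:~R).

(* The system is indexed by k = (m, n) in Z^2 x Z^2. *)
Definition gabor_system (g : R * R -> R) (alpha beta : R)
    (k : (int * int) * (int * int)) : R * R -> rcarried R :=
  modulation (lattice beta k.2)
    (translation (lattice alpha k.1) (fun x => quat_real (g x))).

Definition is_frame (I : choiceType) (h : I -> R * R -> rcarried R) : Prop :=
  exists A B : R, [/\ 0 < A, 0 < B &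
    forall f, L2 f ->
      ((A * L2norm f ^+ 2)%:E <= \esum_(k in [set: I]) (`|L2pairing f (h k)| ^+ 2)%:E)%E
      /\ (\esum_(k in [set: I]) (`|L2pairing f (h k)| ^+ 2)%:E <= (B * L2norm f ^+ 2)%:E)%E].

Definition gaussian (x : R * R) : R := expR (- pi * x.1 ^+ 2 - pi * x.2 ^+ 2).

(* Euler's formula for an imaginary unit u. *)
Lemma quat_exp_unit (t : R) (u : quat R) : Sc u = 0 -> u * u = -1 ->
  quat_exp (quat_real t * u) = quat_real (cos t) + quat_real (sin t) * u.
Proof.
case: u => a b c d; rewrite /Sc /= => ->; set u := Quat 0 b c d => uu.
have rM x y : quat_real x * quat_real y = quat_real (x * y) :> quat R.
  by congr Quat; rewrite /=; ring.
have rX x n : quat_real x ^+ n = quat_real (x ^+ n) :> quat R.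
  by elim: n => [//|n IH]; rewrite !exprS IH rM.
have cu x : GRing.comm (quat_real x) u.
  by rewrite /GRing.comm; congr Quat; rewrite /=; ring.
have uX n : u ^+ n = quat_real ((~~ odd n)%:R * (-1) ^+ n./2)
                   + quat_real ((odd n)%:R * (-1) ^+ n.-1./2) * u.
  elim: n => [|n IH]; first by rewrite /= expr0 mul1r; congr Quat; rewrite /=; ring.
  rewrite exprSr IH mulrDl -mulrA uu /= uphalf_half.
  case: (boolP (odd n)) => on; rewrite /= ?add0n ?add1n ?exprS.
    have -> : n.-1./2 = n./2.
      by case: n on {IH} => //= n; rewrite uphalf_half => /negbTE ->.
    by congr Quat; rewrite /=; ring.
  by congr Quat; rewrite /=; ring.
have E n : (quat_real t * u) ^+ n =
    quat_real ((~~ odd n)%:R * (-1) ^+ n./2 * t ^+ n)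
    + quat_real ((odd n)%:R * (-1) ^+ n.-1./2 * t ^+ n) * u.
  rewrite exprMn_comm // rX uX mulrDr mulrA !rM.
  by congr (quat_real _ + quat_real _ * _); rewrite mulrC.
have sinE x (v : R ^nat) : v = x *: sin_coeff t ->
    lim (series v @ \oo) = x * sin t.
  by move=> ->; rewrite lim_seriesZ ?unlock //; exact: is_cvg_series_sin_coeff.
have cosE (v : R ^nat) : v = cos_coeff t -> lim (series v @ \oo) = cos t.
  by move=> ->; rewrite unlock.
congr Quat; rewrite /=.
- rewrite cosE; first by ring.
  by apply/funext => n; rewrite E /cos_coeff /= -exprnP; ring.
- rewrite (sinE b); first by ring.
  by apply/funext => n; rewrite E -[RHS]/(b * sin_coeff t n) /sin_coeff /=; ring.
- rewrite (sinE c); first by ring.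
  by apply/funext => n; rewrite E -[RHS]/(c * sin_coeff t n) /sin_coeff /=; ring.
- rewrite (sinE d); first by ring.
  by apply/funext => n; rewrite E -[RHS]/(d * sin_coeff t n) /sin_coeff /=; ring.
Qed.

Lemma L2pairing_gaborE f (g : R * R -> R) (b w : R * R) :
  L2pairing f (modulation w (translation b (fun x => quat_real (g x)))) =
  Sc (quat_int (fun x =>
    quat_exp (quat_real (- 2 * pi * x.1 * w.1) * quat_i R) * f x
    * quat_real (g (x.1 - b.1, x.2 - b.2))
    * quat_exp (quat_real (- 2 * pi * x.2 * w.2) * quat_j R))).
Proof.
rewrite /L2pairing; congr (Sc (quat_int _)); apply/funext => x.
rewrite /mul_lcarried /= !(quat_exp_unit, quat_ii, quat_jj) //.
have N (s y : R) : - 2 * pi * s * y = - (2 * pi * y * s) by ring.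
rewrite !N !cosN !sinN.
by case: (f x) => ????; congr Quat; rewrite /=; ring.
Qed.

End QuatAnalysis.

(* Main.v *)
From HB Require Import structures.
Require Import Defs.
From mathcomp Require Import all_boot all_order all_algebra.
From mathcomp Require Import all_classical all_reals all_analysis.
From mathcomp Require Import measurable_realfun ring lra.
Import Order.TTheory GRing.Theory Num.Theory.
Import numFieldNormedType.Exports.
Local Open Scope classical_set_scope.
Local Open Scope ring_scope.

(** The lower frame bound fails because a nonzero function is orthogonal to the
    whole system: f(x) = phi(x) sin(2 pi x1 / alpha), with phi the Gaussian
    ([gaussian_sin]).

    For a real-valued f, the scalar part of the pairing with the element of
    index (m, n) keeps only the cosines of the modulations:
      int f(x) phi(x - alpha m) cos(2 pi n1 x1 / alpha)
                                cos(2 pi n2 x2 / alpha) dx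
    ([L2pairing_real]). Apply the reflection x1 |-> alpha m1 - x1. It exchanges
    the values at x1 and x1 - alpha m1 of the even function exp(-pi t^2), so it
    fixes the product phi(x) phi(x - alpha m); it fixes
    cos(2 pi n1 x1 / alpha), and it changes the sign of sin(2 pi x1 / alpha),
    both functions being alpha-periodic. The integrand is therefore
    antisymmetric under a map that preserves Lebesgue measure, and the integral
    vanishes ([L2pairing_gaussian_sin]). This holds for every index (m, n), so a
    lower frame bound A > 0 would give A |f|^2 <= 0. But f is square integrable,
    since f^2 <= phi, and |f| > 0, since f is positive on the box
    ]0, alpha/2[ x ]0, 1[. *)

Notation plane R := (measurableTypeR R * measurableTypeR R)%type.

(** * Full turns *)

Lemma cos2pi_int (R : realType) (z : int) : cos (2 * pi * z%:~R) = 1 :> R.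
Proof.
have N (n : nat) : cos (2 * pi * n%:R) = 1 :> R.
  have -> : 2 * pi * n%:R = 0 + (pi *+ 2) *+ n :> R.
    by rewrite add0r mulr_natr mulr_natl.
  by rewrite (periodicn (@cosD2pi R)) cos0.
case: z => n; first exact: N.
by rewrite NegzE mulrNz mulrN cosN -pmulrn N.
Qed.

Lemma sin2pi_int (R : realType) (z : int) : sin (2 * pi * z%:~R) = 0 :> R.
Proof.
by apply/eqP; rewrite -(@sqrf_eq0 R) sin2cos2 cos2pi_int expr1n subrr //.
Qed.

(** * Antisymmetric integrands *)

(** A measure-preserving r with F o r = -F exchanges the positive and the
    negative part of F, so these have the same integral. Integrability is not
    assumed: if both integrals are infinite, their difference is an infinite
    value, which [fine] sends to 0. *)
Lemma Rintegral_antisymmetric (d : measure_display) (T : measurableType d)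
    (R : realType) (mu : {measure set T -> \bar R}) (r : {mfun T >-> T})
    (F : T -> R) :
  (forall A, measurable A -> mu (r @^-1` A) = mu A) ->
  measurable_fun setT F -> (forall x, F (r x) = - F x) ->
  \int[mu]_x F x = 0.
Proof.
move=> rmu mF Fr; pose G : T -> \bar R := EFin \o F.
have mG : measurable_fun setT G by exact/measurable_EFinP.
have PN : (\int[mu]_x (G^\+ x) = \int[mu]_x (G^\- x))%E.
  rewrite [RHS](@eq_measure_integral _ _ _ _ (pushforward mu r)); last first.
    by move=> A mA _; exact/esym/rmu.
  rewrite [RHS]ge0_integral_pushforward //; last exact: measurable_funeneg.
  by apply: eq_integral => x _; rewrite /= funeposE funenegE /G /= Fr opprK.
rewrite /Rintegral -/G integralE PN.
by case: (\int[mu]_x G^\- x)%E => //= y; rewrite subrr.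
Qed.

(** * Reflections preserve Lebesgue measure *)

Section reflections.
Variables (R : realType) (c : R).

Definition reflection (x : measurableTypeR R) : measurableTypeR R := c - x.

Lemma measurable_reflection : measurable_fun setT reflection.
Proof. exact: measurable_funB. Qed.

HB.instance Definition _ := isMeasurableFun.Build _ _ _ _ _ measurable_reflection.

Lemma lebesgue_measure_reflection (A : set (measurableTypeR R)) : measurable A ->
  lebesgue_measure (reflection @^-1` A) = lebesgue_measure A.
Proof.
move=> mA; apply/esym.
apply: (@lebesgue_measure_unique R (pushforward (@lebesgue_measure R) reflection)) => //.
move=> _ [[a b] _ <-] /=; rewrite /pushforward.
have -> : reflection @^-1` `]a, b] = `[c - b, c - a[%classic.
  by apply/seteqP; split => x; rewrite /reflection /= !in_itv /=; lra.
rewrite !lebesgue_measure_itv /= !lte_fin ltrD2l ltrN2.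
by case: ifP => // _; congr (_%:E); ring.
Qed.

Definition reflection_fst (x : plane R) : plane R := (reflection x.1, x.2).

Lemma measurable_reflection_fst : measurable_fun setT reflection_fst.
Proof.
apply/measurable_fun_pairP; split => /=; last exact: measurable_snd.
by apply: measurable_funB => //; exact: measurable_fst.
Qed.

HB.instance Definition _ := isMeasurableFun.Build _ _ _ _ _ measurable_reflection_fst.

(** By uniqueness of the product measure, it suffices to look at rectangles,
    where the reflection acts on the first side only. *)
Lemma lebesgue2_reflection_fst (A : set (plane R)) : measurable A ->
  lebesgue2 R (reflection_fst @^-1` A) = lebesgue2 R A.
Proof.
move=> mA; apply/esym.
apply: (product_measure_unique (m' := pushforward (lebesgue2 R) reflection_fst)) => //.
move=> X Y mX mY.
transitivity (lebesgue2 R ((reflection @^-1` X) `*` Y)) => //.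
rewrite [LHS]product_measure1E //; first by congr (_ * _)%E; exact: lebesgue_measure_reflection.
by rewrite -[X in measurable X]setTI; exact: measurable_reflection.
Qed.

End reflections.

(** * The Gaussian *)

Section gaussian.
Variable R : realType.

(** The standard deviation 1 / sqrt(2 pi) is the one for which the normal
    density has no normalizing factor. *)
Lemma gaussianE (x : R * R) :
  gaussian x = normal_pdf 0 (Num.sqrt (2 * pi))^-1 x.1
             * normal_pdf 0 (Num.sqrt (2 * pi))^-1 x.2.
Proof.
have p0 : 0 < pi :> R by exact: pi_gt0.
move: (p0) (@normal_pdfE R); rewrite /normal_peak /gaussian.
move: pi p0 => p p0 _ pdfE.
have s0 : (Num.sqrt (2 * p))^-1 != 0.
  by rewrite invr_eq0 gt_eqF ?sqrtr_gt0 ?mulr_gt0.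
have pn0 : p != 0 by rewrite gt_eqF.
rewrite !pdfE // /normal_fun exprVn sqr_sqrtr ?mulr_ge0 ?ltW //.
have -> : (2 * p)^-1 * p *+ 2 = 1 by field.
rewrite sqrtr1 invr1 !mul1r -expRD; congr expR.
by field.
Qed.

Lemma measurable_gaussian : measurable_fun (setT : set (plane R)) (@gaussian R).
Proof.
apply: measurableT_comp => //; apply: measurable_funB.
  by apply: measurable_funM => //; apply: measurable_funX; exact: measurable_fst.
by apply: measurable_funM => //; apply: measurable_funX; exact: measurable_snd.
Qed.

Lemma integral_gaussian : (\int[lebesgue2 R]_x (gaussian x)%:E = 1)%E.
Proof.
rewrite fubini_tonelli1 //=; last 2 first.
- by apply/measurable_EFinP; exact: measurable_gaussian.
- by move=> x; rewrite lee_fin expR_ge0.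
rewrite -[RHS](integral_normal_pdf 0 (Num.sqrt (2 * pi))^-1).
apply: eq_integral => x _; rewrite /fubini_F.
under eq_integral do rewrite gaussianE EFinM /=.
rewrite ge0_integralZl ?integral_normal_pdf ?mule1 //.
- by apply/measurable_EFinP; exact: measurable_normal_pdf.
- by move=> y _; rewrite lee_fin normal_pdf_ge0.
- by rewrite lee_fin normal_pdf_ge0.
Qed.

End gaussian.

(** * A function orthogonal to the Gabor system *)

(** The scalar part of exp(-2 pi i w1 x1) f exp(-2 pi j w2 x2), for real f, is
    f times the product of the two cosines: the sines occur only on the units
    i, j and k. *)
Lemma L2pairing_real (R : realType) (f g : plane R -> R) (b w : R * R) :
  L2pairing (fun x => quat_real (f x))
    (modulation w (translation b (fun x => quat_real (g x)))) =
  \int[lebesgue2 R]_x (f x * g (x.1 - b.1, x.2 - b.2)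
    * cos (2 * pi * w.1 * x.1) * cos (2 * pi * w.2 * x.2)).
Proof.
rewrite L2pairing_gaborE; apply: (congr1 fine).
apply: eq_integral => x _; apply: (congr1 EFin).
rewrite !quat_exp_unit ?quat_ii ?quat_jj //=.
have N (s y : R) : - 2 * pi * s * y = - (2 * pi * y * s) by ring.
by rewrite !N !cosN !sinN; ring.
Qed.

Section gaussian_sin.
Variables (R : realType) (alpha : R).

Definition gaussian_sin (x : plane R) : R :=
  gaussian x * sin (2 * pi * x.1 / alpha).

Lemma measurable_gaussian_sin : measurable_fun setT gaussian_sin.
Proof.
apply: measurable_funM; first exact: measurable_gaussian.
apply: (measurableT_comp (f := sin)).
  by apply: continuous_measurable_fun; exact: continuous_sin.
apply: measurable_funM => //.
by apply: measurable_funM => //; exact: measurable_fst.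
Qed.

(** The bound f^2 <= phi^2 <= phi, the last step because phi <= 1. *)
Lemma integral_gaussian_sin_sqr_lty :
  (\int[lebesgue2 R]_x (gaussian_sin x ^+ 2)%:E < +oo)%E.
Proof.
apply: (@le_lt_trans _ _ 1%E); last by rewrite ltry.
rewrite -(integral_gaussian R); apply: ge0_le_integral => //.
- by move=> x _; rewrite lee_fin sqr_ge0.
- by apply/measurable_EFinP; apply: measurable_funX; exact: measurable_gaussian_sin.
- by apply/measurable_EFinP; exact: measurable_gaussian.
move=> x _; rewrite lee_fin.
have g0 : 0 <= gaussian x by exact: expR_ge0.
have g1 : gaussian x <= 1.
  have p0 (t : R) : 0 <= pi * t ^+ 2 by rewrite mulr_ge0 ?pi_ge0 ?sqr_ge0.
  by rewrite /gaussian -expR0 ler_expR mulNr subr_le0 (le_trans _ (p0 _)) ?oppr_le0.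
have s1 : sin (2 * pi * x.1 / alpha) ^+ 2 <= 1.
  by rewrite sin2cos2 lerBlDr lerDl sqr_ge0.
by rewrite /gaussian_sin exprMn expr2 -mulrA ler_piMr // mulr_ile1 ?sqr_ge0.
Qed.

(** If the integral were zero, f would vanish almost everywhere, but f is
    positive where 0 < 2 pi x1 / alpha < pi, a set that contains a box of
    measure alpha / 2. *)
Lemma integral_gaussian_sin_sqr_gt0 : 0 < alpha ->
  (0 < \int[lebesgue2 R]_x (gaussian_sin x ^+ 2)%:E)%E.
Proof.
move=> alpha_gt0; rewrite lt0e; apply/andP; split; last first.
  by apply: integral_ge0 => x _; rewrite lee_fin sqr_ge0.
apply/eqP => w0.
have mw : measurable_fun setT (fun x => (gaussian_sin x ^+ 2)%:E).
  by apply/measurable_EFinP; apply: measurable_funX; exact: measurable_gaussian_sin.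
have : (\int[lebesgue2 R]_x `|(gaussian_sin x ^+ 2)%:E| = 0)%E.
  by rewrite -[RHS]w0; apply: eq_integral => x _; rewrite gee0_abs // lee_fin sqr_ge0.
case/(ae_eq_integral_abs _ measurableT mw) => N [mN N0 subN].
pose box : set (plane R) := `]0, alpha / 2[%classic `*` `]0, 1[%classic.
have mbox : measurable box by exact: measurableX.
have : (lebesgue2 R box <= lebesgue2 R N)%E.
  apply: le_measure; rewrite ?inE // => -[x y] [] /=.
  rewrite !in_itv /= => /andP[x0 xa] _; apply: subN => /= /(_ I) [] /eqP.
  rewrite sqrf_eq0 mulf_eq0 gt_eqF ?expR_gt0 //= gt_eqF // sin_gt0_pi //.
  rewrite divr_gt0 ?mulr_gt0 ?pi_gt0 //= ltr_pdivrMr // (mulrC 2) -mulrA.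
  by rewrite ltr_pM2l ?pi_gt0 // mulrC -ltr_pdivlMr.
rewrite N0 measure_le0 => /eqP.
rewrite /lebesgue2 [LHS]product_measure1E //= !lebesgue_measure_itv /= !lte_fin.
rewrite divr_gt0 // ltr01 !oppr0 !adde0 -EFinM mulr1 => -[] /eqP.
by rewrite gt_eqF ?divr_gt0.
Qed.

Lemma L2_gaussian_sin : L2 (fun x => quat_real (gaussian_sin x)).
Proof.
split => //=; first exact: measurable_gaussian_sin.
under eq_integral do rewrite /quat_abs /Sc /= !mul0r !subr0 -expr2 sqr_sqrtr ?sqr_ge0 //.
exact: integral_gaussian_sin_sqr_lty.
Qed.

Lemma L2norm_gaussian_sin_gt0 : 0 < alpha ->
  0 < L2norm (fun x => quat_real (gaussian_sin x)) ^+ 2.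
Proof.
move=> alpha_gt0; set f := fun x => _.
have E : L2inner f f = fine (\int[lebesgue2 R]_x (gaussian_sin x ^+ 2)%:E)%E.
  rewrite /L2inner /Sc /= /Rintegral; congr fine.
  by apply: eq_integral => x _; rewrite /= !oppr0 !mulr0 !subr0 expr2.
have I0 : 0 < fine (\int[lebesgue2 R]_x (gaussian_sin x ^+ 2)%:E)%E.
  by rewrite fine_gt0 // integral_gaussian_sin_sqr_gt0 //; exact: integral_gaussian_sin_sqr_lty.
by rewrite /L2norm E sqr_sqrtr // ltW.
Qed.

(** The integrand is antisymmetric under x1 |-> alpha m1 - x1. *)
Lemma L2pairing_gaussian_sin k : 0 < alpha ->
  L2pairing (fun x => quat_real (gaussian_sin x))
    (gabor_system (@gaussian R) alpha (1 / alpha) k) = 0.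
Proof.
move=> alpha_gt0; case: k => [[m1 m2] [n1 n2]].
rewrite /gabor_system L2pairing_real /=.
have an0 : alpha != 0 by rewrite gt_eqF.
apply: (@Rintegral_antisymmetric _ _ _ (lebesgue2 R) (reflection_fst R (alpha * m1%:~R))).
- by move=> A; exact: lebesgue2_reflection_fst.
- have mc (c : R) (p : plane R -> R) : measurable_fun setT p ->
      measurable_fun setT (fun x => cos (c * p x)).
    move=> mp; apply: (measurableT_comp (f := cos)).
      by apply: continuous_measurable_fun; exact: continuous_cos.
    exact: measurable_funM.
  have mfst : measurable_fun setT (fst : plane R -> measurableTypeR R).
    exact: measurable_fst.
  have msnd : measurable_fun setT (snd : plane R -> measurableTypeR R).
    exact: measurable_snd.
  apply: measurable_funM; last exact: mc.
  apply: measurable_funM; last exact: mc.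
  apply: measurable_funM; first exact: measurable_gaussian_sin.
  apply: (measurableT_comp (@measurable_gaussian R)).
  by apply/measurable_fun_pairP; split; apply: measurable_funB.
move=> [x y]; rewrite /reflection_fst /reflection /gaussian_sin /=.
have -> : 2 * pi * (alpha * m1%:~R - x) / alpha
    = 2 * pi * m1%:~R - 2 * pi * x / alpha by field.
have -> : 2 * pi * (1 / alpha * n1%:~R) * (alpha * m1%:~R - x)
    = 2 * pi * (n1 * m1)%:~R - 2 * pi * (1 / alpha * n1%:~R) * x.
  by rewrite intrM; field.
rewrite sinB cosB !cos2pi_int !sin2pi_int /gaussian /=.
set a := expR _; set b := expR _; set c := expR _; set d := expR _.
(* The reflection exchanges the two Gaussian factors in the first coordinate. *)
have ab : a * b = c * d by rewrite /a /b /c /d -!expRD /reflection; congr expR; ring.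
ring: ab.
Qed.

End gaussian_sin.

Theorem theorem6 (R : realType) (alpha : R) (halpha : 0 < alpha) :
  ~ is_frame (gabor_system (@gaussian R) alpha (1 / alpha)).
Proof.
move=> [A [B [A0 _ /(_ _ (L2_gaussian_sin R alpha)) [lb _]]]].
move: lb; rewrite esum1 => [|k _]; last first.
  by rewrite L2pairing_gaussian_sin // normr0 expr0n.
rewrite lee_fin leNgt => /negP; apply.
by rewrite mulr_gt0 ?L2norm_gaussian_sin_gt0.
Qed.
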